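(* Let $n\ge 3$, $m\ge 2$, let $Q_{n,m}$ be the triangular grid quiver on a cylinder, and let $\boldsymbol{x}=(x_{j,i})$ ($0\le j\le m$, $i\in\mathbb{Z}/n\mathbb{Z}$) be the cluster variables attached to its vertices. For every $1\le j\le m-1$ and every $k\in\mathbb{Z}/n\mathbb{Z}$, the operation $\mathcal{R}_{M_j,k}$ (a sequence of $2n-2$ mutations followed by a transposition of vertices) satisfies $$\mathcal{R}_{M_j,k}(Q_{n,m},\boldsymbol{x})=(Q_{n,m},R_{M_j}(\boldsymbol{x})),$$ i.e. it sends the quiver $Q_{n,m}$ to itself and replaces each cluster variable $x_v$ by $R_{M_j}(x_v)$, where $R_{M_j}$ is the simple cluster $R$-matrix.
   Context: All second indices $i$ are taken in $\mathbb{Z}/n\mathbb{Z}$. Quiver $Q_{n,m}$: vertices $(j,i)$ with $0\le j\le m$, $i\in\mathbb{Z}/n\mathbb{Z}$; arrows $(j,i)\to(j,i+1)$ for $0\le j\le m$; $(j,i)\to(j-1,i)$ for $1\le j\le m$; $(j,i)\to(j+1,i-1)$ for $0\le j\le m-1$. Write $M_j=\{(j,i): i\in\mathbb{Z}/n\mathbb{Z}\}$ for the $j$-th vertical cycle. Seeds and mutation: for a quiver $Q$ without loops or 2-cycles put $b_{uv}=\#\{u\to v\}-\#\{v\to u\}$. The mutation $\mu_k$ at a vertex $k$ sends $(Q,\boldsymbol{x})$ to $(\tilde Q,\tilde{\boldsymbol{x}})$, where $\tilde x_u=x_u$ for $u\ne k$, $\tilde x_k=x_k^{-1}\big(\prod_{u:b_{uk}>0}x_u^{b_{uk}}+\prod_{u:b_{uk}<0}x_u^{-b_{uk}}\big)$,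 and $\tilde b_{uv}=-b_{uv}$ if $u=k$ or $v=k$, $\tilde b_{uv}=b_{uv}+\tfrac12(|b_{uk}|b_{kv}+b_{uk}|b_{kv}|)$ otherwise. Operation $\mathcal{R}_{M,k}$ for $M=M_j$: write $\mu_i$ for the mutation at vertex $(j,i)$ and $s_{i,i'}$ for the exchange of the labels of the vertices $(j,i)$ and $(j,i')$ (acting on the quiver and on the variables). Then $$\mathcal{R}_{M,k}=s_{k-2,k-1}\circ(\mu_k\circ\mu_{k+1}\circ\cdots\circ\mu_{k-4}\circ\mu_{k-3})\circ(\mu_{k-1}\circ\mu_{k-2}\circ\cdots\circ\mu_{k+1}\circ\mu_k),$$ the rightmost operation being applied first: first mutate at $k,k+1,\dots,k+n-1$ (each vertex of $M$ once), then at $k+n-3,k+n-4,\dots,k$ ($n-2$ mutations), then exchange $k-2$ and $k-1$. Simple cluster $R$-matrix: let $\mathcal{F}=\mathbb{Q}(x_{j,i}: 0\le j\le m, i\in\mathbb{Z}/n\mathbb{Z})$. For $1\le j\le m-1$, $R_{M_j}:\mathcal{F}\to\mathcal{F}$ is the rational transformation (field homomorphism) fixing every $x_{j',i}$ with $j'\ne j$ and with $$R_{M_j}(x_{j,i})=\frac{\sum_{l\in\mathbb{Z}/n\mathbb{Z}}x_{j-1,l+1}\Big(\prod_{h\in(\mathbb{Z}/n\mathbb{Z})\setminus\{l,l+1\}}x_{j,h}\Big)x_{j+1,l}}{\prod_{h\ne i}x_{j,h}}.$$ *)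

(* Defs.v *)
From HB Require Import structures.
From mathcomp Require Import all_boot all_order all_algebra.
From mathcomp Require Import perm mpoly.

Set Implicit Arguments.
Unset Strict Implicit.
Unset Printing Implicit Defensive.

Import GRing.Theory Num.Theory.
Local Open Scope ring_scope.

Section Seeds.
Variables (V : finType) (F : fieldType).

(* A quiver is given by its arrow multiplicities: q (u, v) is the number of
   arrows u -> v. *)
Definition quiver := {ffun V * V -> nat}.

Definition seed := (quiver * {ffun V -> F})%type.

Definition exchange_coef (q : quiver) (u v : V) : int :=
  (q (u, v))%:Z - (q (v, u))%:Z.

(* The division is exact: |a| c + a |c| is 0 or 2 |a| c. *)
Definition mutated_coef (q : quiver) (k u v : V) : int :=
  let b := exchange_coef q in
  if (u == k) || (v == k) then - b u v
  else b u v + ((`|b u k| * b k v + b u k * `|b k v|) %/ 2)%Z.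

(* The quiver without loops or 2-cycles whose exchange matrix is the mutated
   one: it has max(b, 0) arrows u -> v. *)
Definition mutate_quiver (k : V) (q : quiver) : quiver :=
  [ffun e => absz (Num.max 0 (mutated_coef q k e.1 e.2))].

Definition mutate_vars (k : V) (q : quiver) (x : {ffun V -> F}) :
    {ffun V -> F} :=
  let b := exchange_coef q in
  [ffun u => if u == k then
     (x k)^-1 * (\prod_(w | 0 < b w k) x w ^ b w k
                 + \prod_(w | b w k < 0) x w ^ (- b w k))
   else x u].

Definition mutation (k : V) (s : seed) : seed :=
  (mutate_quiver k s.1, mutate_vars k s.1 s.2).

(* Successive mutations, the head of the list being applied first. *)
Definition mutations (ks : seq V) (s : seed) : seed :=
  foldl (fun t k => mutation k t) s ks.

Definition exchange_labels (v w : V) (s : seed) : seed :=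
  ([ffun e => s.1 (tperm v w e.1, tperm v w e.2)],
   [ffun u => s.2 (tperm v w u)]).

End Seeds.

Section FractionLift.
Variables (A : idomainType) (K : fieldType) (f : {rmorphism A -> K}).

Lemma frac_numden (x : {fraction A}) :
  x = tofrac \n_(repr x) / tofrac \d_(repr x).
Proof.
have d0 : \d_(repr x) != 0 by apply: denom_ratioP.
have dF0 : tofrac \d_(repr x) != 0 by rewrite tofrac_eq0.
apply: (mulIf dF0); rewrite divfK //.
rewrite -{1}[x]reprK.
unlock tofrac; rewrite -[LHS]FracField.pi_mul; apply/eqmodP => /=.
rewrite /equivf /FracField.equivf /FracField.mulf /=.
by rewrite !numden_Ratio ?mulr1 ?oner_neq0 // mulrC.
Qed.

(* The extension of an injective ring morphism A -> K to the fraction field. *)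
Definition frac_lift of injective f := fun x : {fraction A} =>
  f \n_(repr x) / f \d_(repr x).

Hypothesis f_inj : injective f.

Fact inj_neq0 a : a != 0 -> f a != 0.
Proof. by apply: contraNneq => fa0; apply/eqP/f_inj; rewrite fa0 rmorph0. Qed.

Lemma frac_liftE (a b : A) :
  b != 0 -> frac_lift f_inj (tofrac a / tofrac b) = f a / f b.
Proof.
move=> b0; rewrite /frac_lift; set x := tofrac a / tofrac b.
have d0 : \d_(repr x) != 0 by apply: denom_ratioP.
have eqF : a * \d_(repr x) = \n_(repr x) * b.
  apply/eqP; rewrite -tofrac_eq !rmorphM /= -eqr_div ?tofrac_eq0 //.
  by rewrite -/x -frac_numden.
by apply/esym/eqP; rewrite eqr_div ?inj_neq0 // -!rmorphM eqF.
Qed.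

Lemma frac_lift_tofrac a : frac_lift f_inj (tofrac a) = f a.
Proof.
by rewrite -[tofrac a]divr1 -tofrac1 frac_liftE ?oner_neq0 // rmorph1 divr1.
Qed.

Fact frac_lift_zmod_morphism : zmod_morphism (frac_lift f_inj).
Proof.
move=> x y; rewrite [x]frac_numden [y]frac_numden.
move: (denom_ratioP (repr x)) (denom_ratioP (repr y)).
move: \n_(repr x) \d_(repr x) \n_(repr y) \d_(repr y) => a b c d b0 d0.
rewrite -mulNr addf_div ?tofrac_eq0 // -rmorphN -!rmorphM -rmorphD /=.
rewrite !frac_liftE ?mulf_neq0 // -mulNr addf_div ?inj_neq0 //.
by rewrite rmorphD !rmorphM rmorphN.
Qed.

Fact frac_lift_monoid_morphism : monoid_morphism (frac_lift f_inj).
Proof.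
split=> [|x y]; first by rewrite -tofrac1 frac_lift_tofrac rmorph1.
rewrite [x]frac_numden [y]frac_numden.
move: (denom_ratioP (repr x)) (denom_ratioP (repr y)).
move: \n_(repr x) \d_(repr x) \n_(repr y) \d_(repr y) => a b c d b0 d0.
rewrite mulf_div -!rmorphM /= !frac_liftE ?mulf_neq0 //.
by rewrite mulf_div !rmorphM.
Qed.

HB.instance Definition _ := GRing.isZmodMorphism.Build _ _
  (frac_lift f_inj) frac_lift_zmod_morphism.
HB.instance Definition _ := GRing.isMonoidMorphism.Build _ _
  (frac_lift f_inj) frac_lift_monoid_morphism.

End FractionLift.

Section InvolutiveFraction.
Variables (A : idomainType) (f : {rmorphism A -> {fraction A}}).

(* The extension of f to fractions, evaluated at f p, makes sense and is p. *)
Definition fixed_twice (p : A) := exists d q,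
  [/\ f p * tofrac d = tofrac q, f d != 0 & f q = tofrac p * f d].

Lemma fixed_twiceD p q : fixed_twice p -> fixed_twice q -> fixed_twice (p + q).
Proof.
move=> [d1 [q1 [a1 b1 c1]]] [d2 [q2 [a2 b2 c2]]].
exists (d1 * d2), (q1 * d2 + d1 * q2); rewrite !rmorphD !rmorphM.
split; last by rewrite c1 c2 mulrDl [f d1 * _]mulrCA !mulrA.
  by rewrite mulrDl mulrA a1 [f q * _]mulrCA a2.
by rewrite mulf_neq0.
Qed.

Lemma fixed_twiceM p q : fixed_twice p -> fixed_twice q -> fixed_twice (p * q).
Proof.
move=> [d1 [q1 [a1 b1 c1]]] [d2 [q2 [a2 b2 c2]]].
exists (d1 * d2), (q1 * q2); rewrite !rmorphM.
split; last by rewrite c1 c2 mulrACA.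
  by rewrite mulrACA a1 a2.
by rewrite mulf_neq0.
Qed.

Lemma fixed_twice1 p : f p = tofrac p -> fixed_twice p.
Proof.
by move=> fp; exists 1, p; rewrite fp !rmorph1 !mulr1; split; rewrite ?oner_neq0.
Qed.

Lemma fixed_twiceX p k : fixed_twice p -> fixed_twice (p ^+ k).
Proof.
move=> fp; elim: k => [|k IH]; first by apply: fixed_twice1; rewrite expr0 !rmorph1.
by rewrite exprS; apply: fixed_twiceM.
Qed.

Lemma fixed_twice_inj : (forall p, fixed_twice p) -> injective f.
Proof.
move=> fA; apply: raddf_inj => p pE; have [d [q [a b c]]] := fA p.
move: a; rewrite pE mul0r => /esym/eqP; rewrite tofrac_eq0 => /eqP q0.
by move/esym/eqP: c; rewrite q0 rmorph0 mulf_eq0 (negPf b) orbF tofrac_eq0 => /eqP.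
Qed.

End InvolutiveFraction.

(* The field Q(x_v : v in V). *)
Notation ratfun V := {fraction {mpoly rat[#|V|]}}.

Section RationalFunctions.
Variable V : finType.

Definition pvar (v : V) : {mpoly rat[#|V|]} := 'X_(enum_rank v).
Definition var (v : V) : ratfun V := tofrac (pvar v).

(* The substitution x_v := h v on polynomials. *)
Definition poly_subst (h : V -> ratfun V) : {rmorphism {mpoly rat[#|V|]} -> ratfun V} :=
  mmap (@tofrac _ \o @mpolyC _ rat) (h \o enum_val).

Lemma poly_subst_var h v : poly_subst h (pvar v) = h v.
Proof. by rewrite /poly_subst /= mmapX mmap1U /= enum_rankK. Qed.

Lemma poly_substC h c : poly_subst h c%:MP = tofrac c%:MP.
Proof. by rewrite /poly_subst /= mmapC. Qed.

Lemma poly_subst_inj (h : V -> ratfun V) :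
  (forall v, fixed_twice (poly_subst h) (pvar v)) -> injective (poly_subst h).
Proof.
move=> hv; apply: fixed_twice_inj; set f := poly_subst h.
have fC c : fixed_twice f c%:MP by apply: fixed_twice1; apply: poly_substC.
have fX m : fixed_twice f 'X_[m].
  rewrite mpolyXE_id; elim/big_rec: _ => [|i p _ fp].
    by apply: fixed_twice1; rewrite !rmorph1.
  apply: fixed_twiceM fp; apply: fixed_twiceX.
  by move: (hv (enum_val i)); rewrite /pvar enum_valK.
elim/mpolyind=> [|c m p _ _ fp]; first by apply: fixed_twice1; rewrite !rmorph0.
by apply: fixed_twiceD => //; rewrite -mul_mpolyC; apply: fixed_twiceM.
Qed.

End RationalFunctions.

Section CylinderQuiver.
Variables (n m : nat).

(* 'Z_n is the ring of integers modulo n as soon as n > 1. *)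
Definition vertex : finType := ('I_m.+1 * 'Z_n)%type.

Definition arrows (u v : vertex) : nat :=
  ((v.1 == u.1) && (v.2 == u.2 + 1))
  + ((u.1 == v.1.+1 :> nat) && (v.2 == u.2))
  + ((v.1 == u.1.+1 :> nat) && (v.2 == u.2 - 1)).

Definition cylinder_quiver : quiver vertex := [ffun e => arrows e.1 e.2].

Definition initial_seed : seed vertex (ratfun vertex) :=
  (cylinder_quiver, [ffun v => var v]).

Variable j : 'I_m.+1.

(* The mutations at k, k+1, ..., k+n-1, then at k+n-3, ..., k+1, k, and the
   exchange of k-2 and k-1, all in the j-th vertical cycle. *)
Definition R_operation (F : fieldType) (k : 'Z_n) (s : seed vertex F) :
    seed vertex F :=
  let up := [seq (j, k + i%:R) | i <- iota 0 n] in
  let down := [seq (j, k + i%:R) | i <- rev (iota 0 (n - 2))] in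
  exchange_labels ((j, k - 2) : vertex) (j, k - 1)
    (mutations down (mutations up s)).

(* inord is junk out of range, but 0 < j < m is assumed where these are used. *)
Let jpred : 'I_m.+1 := inord j.-1.
Let jsucc : 'I_m.+1 := inord j.+1.

Definition R_num (A : comNzRingType) (y : vertex -> A) : A :=
  \sum_(l : 'Z_n) y (jpred, l + 1)
    * (\prod_(h : 'Z_n | (h != l) && (h != l + 1)) y (j, h)) * y (jsucc, l).

Definition R_den (A : comNzRingType) (y : vertex -> A) (i : 'Z_n) : A :=
  \prod_(h : 'Z_n | h != i) y (j, h).

(* The images of the variables under the R-matrix of the j-th cycle. *)
Definition R_image (v : vertex) : ratfun vertex :=
  if v.1 == j then R_num (@var vertex) / R_den (@var vertex) v.2 else var v.

Lemma R_num_morph (A B : comNzRingType) (f : {rmorphism A -> B}) y :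
  f (R_num y) = R_num (f \o y).
Proof.
rewrite /R_num rmorph_sum; apply: eq_bigr => l _.
by rewrite !rmorphM rmorph_prod.
Qed.

Lemma R_den_morph (A B : comNzRingType) (f : {rmorphism A -> B}) y i :
  f (R_den y i) = R_den (f \o y) i.
Proof. by rewrite /R_den rmorph_prod. Qed.

Lemma R_num_eq (A : comNzRingType) (y z : vertex -> A) :
  y =1 z -> R_num y = R_num z.
Proof.
move=> yz; apply: eq_bigr => l _; rewrite !yz.
by congr (_ * _ * _); apply: eq_bigr.
Qed.

Lemma R_den_scale (A : comNzRingType) (y z : vertex -> A) c i :
  (forall h, z (j, h) = c * y (j, h)) ->
  R_den z i = c ^+ (Zp_trunc n).+1 * R_den y i.
Proof.
move=> zE; rewrite /R_den (eq_bigr _ (fun h _ => zE h)) big_split /=.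
rewrite prodr_const; congr (_ ^+ _ * _).
by rewrite (cardC1 i) card_ord.
Qed.

Lemma R_num_scale (A : comNzRingType) (y z : vertex -> A) c :
  (forall h, z (j, h) = c * y (j, h)) -> (forall v, v.1 != j -> z v = y v) ->
  jpred != j -> jsucc != j -> R_num z = c ^+ Zp_trunc n * R_num y.
Proof.
move=> zj zE jp js; rewrite /R_num mulr_sumr; apply: eq_bigr => l _.
rewrite !zE // (eq_bigr _ (fun h _ => zj h)) big_split /= prodr_const.
rewrite (_ : #|_| = Zp_trunc n); first by rewrite -!mulrA mulrCA.
have l1 : l + 1 != l by rewrite -subr_eq0 addrC addKr oner_eq0.
have := cardC (pred2 l (l + 1)); rewrite card2 eq_sym l1 card_ord => -[].
by apply: etrans; apply: eq_card => h; rewrite !inE negb_or.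
Qed.

Lemma R_num_pvar_neq0 : R_num (@pvar vertex) != 0.
Proof.
apply/eqP => /(congr1 (meval (fun=> 1 : rat))); rewrite R_num_morph rmorph0.
have E v : (meval (fun=> 1 : rat) \o @pvar vertex) v = 1 by rewrite /= mevalXU.
rewrite (R_num_eq E) /R_num (eq_bigr (fun=> 1)) => [|l _]; last first.
  by rewrite big1_eq !mulr1.
by rewrite sumr_const card_ord => /eqP; rewrite pnatr_eq0.
Qed.

Lemma R_involutive (K : fieldType) (x z : vertex -> K) i :
  (forall v, x v != 0) -> R_num x != 0 -> jpred != j -> jsucc != j ->
  (forall v, z v = if v.1 == j then R_num x / R_den x v.2 else x v) ->
  [/\ z (j, i) * R_den x i = R_num x, R_den z i != 0
    & R_num z = x (j, i) * R_den z i].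
Proof.
move=> x0 num0 jp js zE.
pose P := \prod_h x (j, h); pose T := R_num x / P.
have P0 : P != 0 by apply/prodf_neq0.
have T0 : T != 0 by rewrite mulf_neq0 ?invr_eq0.
have den0 h : R_den x h != 0 by apply/prodf_neq0.
have denE h : x (j, h) * R_den x h = P by rewrite /P (bigD1 h).
have zT h : z (j, h) = T * x (j, h).
  by rewrite zE eqxx /T -(denE h) invfM mulrA mulrAC divfK.
have zx v : v.1 != j -> z v = x v by rewrite zE => /negPf->.
rewrite (R_den_scale i zT) (R_num_scale zT zx jp js) zE eqxx divfK //.
split=> //; first by rewrite mulf_neq0 ?expf_neq0.
by rewrite mulrCA denE exprSr -mulrA divfK.
Qed.

Hypothesis hj : (0 < j < m)%N.

Lemma R_image_inj : injective (poly_subst R_image).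
Proof.
have [j0 jm] := andP hj.
have jp : jpred != j.
  rewrite -val_eqE /= inordK; first by case: (j : nat) j0 => //= k _; rewrite ltn_eqF.
  by rewrite ltnS (leq_trans (leq_pred _)) // ltnW.
have js : jsucc != j by rewrite -val_eqE /= inordK ?ltnS // gtn_eqF.
have var0 (v : vertex) : var v != 0.
  rewrite tofrac_eq0; apply/eqP => /(congr1 (meval (fun=> 1 : rat))).
  by rewrite mevalXU rmorph0 => /eqP; rewrite oner_eq0.
have num0 : R_num (@var vertex) != 0.
  by rewrite -(R_num_morph (@tofrac _)) tofrac_eq0 R_num_pvar_neq0.
apply: poly_subst_inj => -[a i].
have [-> {a}|aj] := eqVneq a j; last first.
  by apply: fixed_twice1; rewrite poly_subst_var /R_image (negPf aj).
have [|e1 e2 e3] := R_involutive (z := poly_subst R_image \o @pvar vertex)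
  i var0 num0 jp js.
  by move=> v; rewrite /= poly_subst_var.
exists (R_den (@pvar vertex) i), (R_num (@pvar vertex)).
by rewrite !R_num_morph !R_den_morph; split.
Qed.

(* The simple cluster R-matrix, as a field endomorphism. *)
Definition cluster_R : {rmorphism ratfun vertex -> ratfun vertex} :=
  frac_lift R_image_inj.

Lemma cluster_R_var v : cluster_R (var v) = R_image v.
Proof. by rewrite [LHS]frac_lift_tofrac poly_subst_var. Qed.

End CylinderQuiver.

(* Main.v *)
Require Import Defs.
From mathcomp Require Import all_boot all_order all_algebra.
From mathcomp Require Import perm mpoly.
From mathcomp Require Import ring zify.

(** Write y_i for the variable at the i-th vertex of the j-th cycle, counted
    from k, and p_i for the product of the two neighbouring variables
    x_(j-1,k+i+1) and x_(j+1,k+i). In the initial quiver the arrows at y_i are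
    y_(i-1), p_i -> y_i -> y_(i+1), p_(i-1), so that each p_i behaves as a single
    vertex. With the terms t_i = p_i / (y_i y_(i+1)), the partial sums
    S_s = t_(n-1) + t_0 + ... + t_(s-1) and T = S_(n-1), the R-matrix is just
    y_i |-> T y_i (R_image_partial_sum).

    The sweep mutates at y_0, ..., y_(n-3). Just before the mutation at y_s the
    arrows at y_s are y_(n-1), p_s -> y_s -> y_(s+1), y_(s-1) (with p_(n-1) in
    place of y_(s-1) when s = 0), so, by induction, y_s is replaced by
    y_(s+1) y_(n-1) S_(s+1) (sweep_cyc). Only three kinds of rows of the
    exchange matrix have to be followed to see this (rows_after): the row of
    the next vertex, that of y_(n-1), and those of the vertices not yet reached.

    After the sweep the rows of y_(n-2) and y_(n-1) are opposite to each other.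
    Hence mutating at both and exchanging their labels gives back the same
    quiver (opposite_rows_exchange), while the new variables at these vertices
    are T y_(n-2) and T y_(n-1). The point is that this seed is also the
    result of a sweep: the one that starts from the original quiver with every
    y_i replaced by T y_i (turn_sweep). Indeed this scaling divides each t_i by
    T^2 and so does not change y_(s+1) y_(n-1) S_(s+1).

    The remaining mutations, at y_(n-3), ..., y_0, commute with the
    exchange of the last two labels and undo this second sweep one mutation
    after the other (sweepK), so they end at the original quiver with the
    variables T y_i. No intermediate variable vanishes, because all of them are
    subtraction-free expressions in the variables (positive). *)

Set Implicit Arguments.
Unset Strict Implicit.
Unset Printing Implicit Defensive.

Import GRing.Theory Num.Theory.
Local Open Scope ring_scope.

(** * Quivers without 2-cycles and their mutations *)

Section Mutation.
Variables (V : finType) (F : fieldType).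
Implicit Types (q : quiver V) (x : {ffun V -> F}) (k u v : V).

Definition two_acyclic q := forall u v, (minn (q (u, v)) (q (v, u)) = 0)%N.

Lemma exchange_coefN q u v : exchange_coef q v u = - exchange_coef q u v.
Proof. by rewrite /exchange_coef opprB. Qed.

(** Lets arrow multiplicities be read off an exchange matrix: without
    2-cycles the two terms of a difference with disjoint supports are the
    outgoing and incoming multiplicities. *)
Lemma arrows_from_coef q u v (a b : nat) : two_acyclic q ->
  exchange_coef q u v = a%:Z - b%:Z -> minn a b = 0%N ->
  q (u, v) = a /\ q (v, u) = b.
Proof. by move=> /(_ u v); rewrite /exchange_coef; lia. Qed.

Lemma two_acyclic_inj q q' : two_acyclic q -> two_acyclic q' ->
  exchange_coef q =2 exchange_coef q' -> q = q'.
Proof.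
move=> qP q'P qq'; apply/ffunP => -[u v].
by have [] := arrows_from_coef qP (qq' u v) (q'P u v).
Qed.

(** The halved sum of the mutation rule counts the paths u -> k -> v minus the
    paths v -> k -> u; in this form no division is left. *)
Lemma mutated_coefE q k u v : two_acyclic q -> u != k -> v != k ->
  mutated_coef q k u v =
    exchange_coef q u v
    + (q (u, k) * q (k, v))%N%:Z - (q (v, k) * q (k, u))%N%:Z.
Proof.
move=> qP uk vk; rewrite /mutated_coef (negPf uk) (negPf vk) /= -[RHS]addrA.
apply: (congr1 (+%R _)); rewrite /exchange_coef; move: (qP u k) (qP k v).
move: (q (u, k)) (q (k, u)) (q (k, v)) (q (v, k)) => a a' c c' aa cc.
have -> : `|a%:Z - a'%:Z| = a%:Z + a'%:Z by lia.
have -> : `|c%:Z - c'%:Z| = c%:Z + c'%:Z by lia.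
rewrite -[RHS](@mulzK _ 2) //; congr (_ %/ _)%Z.
by rewrite !PoszM; ring.
Qed.

Lemma mutated_coef_skew q k u v :
  two_acyclic q -> mutated_coef q k v u = - mutated_coef q k u v.
Proof.
move=> qP; have [uvk|] := boolP ((u == k) || (v == k)).
  by rewrite /mutated_coef uvk orbC uvk exchange_coefN.
by rewrite negb_or => /andP[uk vk]; rewrite !mutated_coefE // exchange_coefN; lia.
Qed.

Lemma exchange_coef_mutate q k u v : two_acyclic q ->
  exchange_coef (mutate_quiver k q) u v = mutated_coef q k u v.
Proof.
move=> qP; rewrite /exchange_coef !ffunE /= (mutated_coef_skew k u v qP); lia.
Qed.

Lemma two_acyclic_mutate q k : two_acyclic q -> two_acyclic (mutate_quiver k q).
Proof.
move=> qP u v; rewrite !ffunE /= (mutated_coef_skew k u v qP); lia.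
Qed.

Lemma mutate_quiverK q k :
  two_acyclic q -> mutate_quiver k (mutate_quiver k q) = q.
Proof.
move=> qP; have q'P := two_acyclic_mutate k qP.
have q'k w : mutate_quiver k q (w, k) = q (k, w)
             /\ mutate_quiver k q (k, w) = q (w, k).
  apply: arrows_from_coef => //; rewrite exchange_coef_mutate //.
  by rewrite /mutated_coef eqxx orbT opprB.
apply: two_acyclic_inj => // [|u v]; first exact: two_acyclic_mutate.
rewrite exchange_coef_mutate //.
have [uvk|] := boolP ((u == k) || (v == k)).
  by rewrite /mutated_coef uvk exchange_coef_mutate // /mutated_coef uvk opprK.
rewrite negb_or => /andP[uk vk].
rewrite mutated_coefE // exchange_coef_mutate // mutated_coefE //.
by rewrite !(q'k _).1 !(q'k _).2; lia.
Qed.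

(** The next three lemmas give the new row of a vertex with no arrow, a single
    arrow, or a single arrow in the other direction between it and k. They are
    all that the tracking of rows uses: the correction at v = k, twice the
    coefficient, turns the old entry into its opposite. *)
Lemma mutate_row0 q k u : two_acyclic q -> u != k -> exchange_coef q u k = 0 ->
  exchange_coef (mutate_quiver k q) u =1 exchange_coef q u.
Proof.
move=> qP uk uk0 v; rewrite exchange_coef_mutate //.
have [->|vk] := eqVneq v k; first by rewrite /mutated_coef eqxx orbT uk0 oppr0.
have [E1 E2] : q (u, k) = 0%N /\ q (k, u) = 0%N by apply: arrows_from_coef.
by rewrite mutated_coefE // E1 E2 mul0n muln0 subr0 addr0.
Qed.

Lemma mutate_row_source q k u v : two_acyclic q -> exchange_coef q u k = 1 ->
  exchange_coef (mutate_quiver k q) u v =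
    exchange_coef q u v + (q (k, v))%:Z - ((v == k).*2)%:Z.
Proof.
move=> qP uk1; rewrite exchange_coef_mutate //.
have kk : q (k, k) = 0%N by have := qP k k; lia.
have [->|vk] := eqVneq v k.
  by rewrite /mutated_coef eqxx orbT uk1 kk.
have uk : u != k by apply/eqP=> E; move: uk1; rewrite E /exchange_coef subrr.
have [E1 E2] : q (u, k) = 1%N /\ q (k, u) = 0%N by apply: arrows_from_coef.
by rewrite mutated_coefE // E1 E2 mul1n muln0 !subr0.
Qed.

Lemma mutate_row_target q k u v : two_acyclic q -> exchange_coef q u k = -1 ->
  exchange_coef (mutate_quiver k q) u v =
    exchange_coef q u v - (q (v, k))%:Z + ((v == k).*2)%:Z.
Proof.
move=> qP uk1; rewrite exchange_coef_mutate //.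
have kk : q (k, k) = 0%N by have := qP k k; lia.
have [->|vk] := eqVneq v k.
  by rewrite /mutated_coef eqxx orbT uk1 kk.
have uk : u != k by apply/eqP=> E; move: uk1; rewrite E /exchange_coef subrr.
have [E1 E2] : q (u, k) = 0%N /\ q (k, u) = 1%N by apply: arrows_from_coef.
by rewrite mutated_coefE // E1 E2 muln1 mul0n !addr0.
Qed.

(** The numerator of the exchange relation at k, written with arrow
    multiplicities, so that no sign condition remains in the index sets. *)
Definition exchange_poly q k x : F :=
  \prod_w x w ^+ q (w, k) + \prod_w x w ^+ q (k, w).

Lemma mutate_varsE q k x u : two_acyclic q ->
  mutate_vars k q x u = if u == k then exchange_poly q k x / x k else x u.
Proof.
move=> qP; rewrite ffunE; case: ifP => // _; rewrite mulrC; congr (_ / _).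
congr (_ + _); rewrite [LHS]big_mkcond; apply: eq_bigr => w _.
  have := qP w k; rewrite /exchange_coef; case: ifPn => [b0 m0|]; last first.
    by case: (q (w, k)) => [|a] b0 m0; [rewrite expr0 | lia].
  by rewrite (_ : q (k, w) = 0%N) ?subr0 -?exprnP //; lia.
have := qP w k; rewrite /exchange_coef; case: ifPn => [b0 m0|]; last first.
  by case: (q (k, w)) => [|a] b0 m0; [rewrite expr0 | lia].
by rewrite (_ : q (w, k) = 0%N) ?sub0r ?opprK -?exprnP //; lia.
Qed.

Lemma mutation_neq q k x u : u != k -> (mutation k (q, x)).2 u = x u.
Proof. by rewrite ffunE => /negPf->. Qed.

Lemma mutation_eq q k x : two_acyclic q ->
  (mutation k (q, x)).2 k = exchange_poly q k x / x k.
Proof. by move=> qP; rewrite mutate_varsE // eqxx. Qed.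

(** The mutation reverses the arrows at k and keeps the other variables, so the
    second exchange relation has the same numerator E as the first one, and
    E / (E / x_k) = x_k as soon as E is nonzero. *)
Lemma mutationK q k x : two_acyclic q -> x k != 0 ->
  (mutation k (q, x)).2 k != 0 -> mutation k (mutation k (q, x)) = (q, x).
Proof.
move=> qP xk; have q'P := two_acyclic_mutate k qP.
have kk q' : two_acyclic q' -> q' (k, k) = 0%N by move/(_ k k); lia.
rewrite mutation_eq // mulf_eq0 negb_or => /andP[E0 _].
congr (_, _); first exact: mutate_quiverK.
apply/ffunP => u; rewrite mutate_varsE // [(mutation _ _).2 u]mutate_varsE //.
case: eqVneq => // ->; rewrite mutation_eq //.
have -> : exchange_poly (mutate_quiver k q) k (mutate_vars k q x)
          = exchange_poly q k x.
  have q'k w : mutate_quiver k q (w, k) = q (k, w)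
               /\ mutate_quiver k q (k, w) = q (w, k).
    apply: arrows_from_coef => //; rewrite exchange_coef_mutate //.
    by rewrite /mutated_coef eqxx orbT opprB.
  rewrite /exchange_poly addrC; congr (_ + _); apply: eq_bigr => w _.
    rewrite (q'k w).2 mutate_varsE //; case: eqVneq => // ->.
    by rewrite kk // !expr0.
  rewrite (q'k w).1 mutate_varsE //; case: eqVneq => // ->.
  by rewrite kk // !expr0.
by rewrite invf_div mulrC divfK.
Qed.

Lemma exchange_labels_mutation a b k (s : seed V F) :
  exchange_labels a b (mutation k s)
  = mutation (tperm a b k) (exchange_labels a b s).
Proof.
case: s => q x; set t := tperm a b.
have tk u : (t u == k) = (u == t k) by rewrite -(inj_eq (@perm_inj _ t)) tpermK.
have coefE u v :
    exchange_coef (exchange_labels a b (q, x)).1 u v = exchange_coef q (t u) (t v).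
  by rewrite /exchange_coef !ffunE.
congr (_, _); apply/ffunP.
  by case=> u v; rewrite !ffunE /mutated_coef /= !coefE !tk tpermK.
move=> u; rewrite !ffunE tk tpermK; case: ifP => // _; congr (_ * (_ + _)).
  rewrite (reindex_inj (@perm_inj _ t)); apply: eq_big => w.
    by rewrite coefE tpermK.
  by rewrite coefE tpermK ffunE.
rewrite (reindex_inj (@perm_inj _ t)); apply: eq_big => w.
  by rewrite coefE tpermK.
by rewrite coefE tpermK ffunE.
Qed.

(** As the coefficient between a and b is then zero, the mutation at a does not
    affect the row of b, and the paths that the two mutations create through a
    and b are opposite and cancel. The only remaining effect is the sign change
    of the two opposite rows, which is their exchange. *)
Lemma opposite_rows_exchange q a b : two_acyclic q -> a != b ->
  (forall v, exchange_coef q b v = - exchange_coef q a v) ->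
  [ffun e => mutate_quiver b (mutate_quiver a q)
               (tperm a b e.1, tperm a b e.2)] = q.
Proof.
move=> qP ab opp; have q1P := two_acyclic_mutate a qP.
have q2P := two_acyclic_mutate b q1P; set t := tperm a b.
have coefxx q' u : exchange_coef q' u u = 0 by rewrite /exchange_coef subrr.
have cab : exchange_coef q a b = 0 by rewrite exchange_coefN opp coefxx !oppr0.
have cba : exchange_coef q b a = 0 by rewrite exchange_coefN cab oppr0.
have rowb := mutate_row0 qP (negbT (etrans (eq_sym _ _) (negbTE ab))) cba.
have q1b v : mutate_quiver a q (b, v) = q (v, a)
             /\ mutate_quiver a q (v, b) = q (a, v).
  by apply: arrows_from_coef => //; rewrite rowb opp /exchange_coef opprB.
have q1a v : exchange_coef (mutate_quiver a q) a v = - exchange_coef q a v.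
  by rewrite exchange_coef_mutate // /mutated_coef eqxx.
have ca v : exchange_coef (mutate_quiver b (mutate_quiver a q)) a v
            = - exchange_coef q a v.
  have [->|vb] := eqVneq v b.
    by rewrite exchange_coef_mutate // /mutated_coef eqxx orbT q1a cab.
  rewrite exchange_coef_mutate // mutated_coefE // q1a.
  have -> : mutate_quiver a q (a, b) = 0%N by rewrite (q1b a).2 -(qP a a) minnn.
  have -> : mutate_quiver a q (b, a) = 0%N by rewrite (q1b a).1 -(qP a a) minnn.
  by rewrite muln0 mul0n addr0 subr0.
have cb v : exchange_coef (mutate_quiver b (mutate_quiver a q)) b v
            = exchange_coef q a v.
  by rewrite exchange_coef_mutate // /mutated_coef eqxx /= rowb opp opprK.
apply: two_acyclic_inj => // [u v|u v].
  by have := q2P (t u) (t v); rewrite !ffunE.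
have -> : exchange_coef [ffun e => mutate_quiver b (mutate_quiver a q)
            (t e.1, t e.2)] u v
          = exchange_coef (mutate_quiver b (mutate_quiver a q)) (t u) (t v).
  by rewrite /exchange_coef !ffunE.
rewrite /t; case: (tpermP a b u) => [->|->|/eqP ua /eqP ub].
- by rewrite cb; case: tpermP => [->|->|//]; rewrite ?cab ?coefxx.
- by rewrite ca opp; case: tpermP => [->|->|//]; rewrite ?cab ?coefxx.
case: (tpermP a b v) => [->|->|/eqP va /eqP vb].
- by rewrite exchange_coefN cb -exchange_coefN.
- by rewrite exchange_coefN ca -opp -exchange_coefN.
rewrite exchange_coef_mutate // mutated_coefE // exchange_coef_mutate //.
by rewrite mutated_coefE // !(q1b _).1 !(q1b _).2 !PoszM; ring.
Qed.

End Mutation.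

(** * Mutating along one cycle of the cylinder *)

Section Sweep.
Variables (n m : nat) (j : 'I_m.+1) (k : 'Z_n).
Hypotheses (n3 : (3 <= n)%N) (hj : (0 < j < m)%N).

Local Notation V := (vertex n m).

Let jpred : 'I_m.+1 := inord j.-1.
Let jsucc : 'I_m.+1 := inord j.+1.

Lemma val_jpred : jpred = j.-1 :> nat.
Proof. by rewrite inordK //; lia. Qed.

Lemma val_jsucc : jsucc = j.+1 :> nat.
Proof. by rewrite inordK //; lia. Qed.

Lemma jpred_neq : jpred != j.
Proof. by rewrite -val_eqE /= val_jpred; lia. Qed.

Lemma jsucc_neq : jsucc != j.
Proof. by rewrite -val_eqE /= val_jsucc; lia. Qed.

Lemma jpred_neq_jsucc : jpred != jsucc.
Proof. by rewrite -val_eqE /= val_jpred val_jsucc; lia. Qed.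

(** Positions are natural numbers counted from k, so that the inductions along
    the cycle run over nat; west i and east i are the two vertices outside the
    cycle that send an arrow to cyc i, and whose variables appear together as
    the factor of the i-th term of the R-matrix. *)
Definition cyc i : V := (j, k + i%:R).
Definition west i : V := (jpred, k + i%:R + 1).
Definition east i : V := (jsucc, k + i%:R).

Lemma Zn_natr_inj i i' : (i < n)%N -> (i' < n)%N ->
  (k + i%:R == k + i'%:R :> 'Z_n) = (i == i').
Proof.
move=> lin li'n; rewrite (inj_eq (addrI k)) -val_eqE /= !val_Zp_nat ?modn_small //.
all: lia.
Qed.

Lemma cyc_inj i i' : (i < n)%N -> (i' < n)%N -> (cyc i == cyc i') = (i == i').
Proof. by move=> *; rewrite xpair_eqE eqxx Zn_natr_inj. Qed.

Lemma cyc_period : cyc n = cyc 0.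
Proof. by rewrite /cyc pchar_Zp //; lia. Qed.

Lemma in_cycle (v : V) : v.1 = j -> exists2 i, (i < n)%N & v = cyc i.
Proof.
case: v => a h /= ->; exists (h - k : 'Z_n); last first.
  by rewrite /cyc natr_Zp addrC subrK.
by rewrite -[X in (_ < X)%N](@Zp_cast n) ?ltn_ord //; lia.
Qed.

(** Rows of the exchange matrix are written as differences of sums of these
    indicator functions. *)
Definition cyc_ind i (v : V) : nat := (v == cyc i).
Definition side_ind i (v : V) : nat := (v == west i) + (v == east i).
(** The second target of cyc s when its turn comes. The pair of index n - 1 in
    the case s = 0 takes the place of a mutated vertex preceding cyc 0: this
    is what makes the invariant hold from the very beginning. *)
Definition back_ind s : V -> nat := if s is s'.+1 then cyc_ind s' else side_ind n.-1.

Lemma back_ind_pred s : (0 < s)%N -> back_ind s = cyc_ind s.-1.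
Proof. by case: s. Qed.

Lemma cyc_ind_cyc i i' : (i < n)%N -> (i' < n)%N -> cyc_ind i (cyc i') = (i' == i).
Proof. by move=> *; rewrite /cyc_ind cyc_inj. Qed.

Lemma side_ind_cyc i i' : side_ind i (cyc i') = 0%N.
Proof.
by rewrite /side_ind !xpair_eqE !(eq_sym j) (negPf jpred_neq) (negPf jsucc_neq).
Qed.

Lemma back_ind_cyc s i : (s < n)%N -> (i < n)%N -> back_ind s (cyc i) = (i.+1 == s).
Proof. by case: s => [|s] sn lin; rewrite /= ?side_ind_cyc ?cyc_ind_cyc //; lia. Qed.

Lemma cyc_ind_disjoint i i' v : (i < n)%N -> (i' < n)%N -> i != i' ->
  minn (cyc_ind i v) (cyc_ind i' v) = 0%N.
Proof.
move=> lin li'n; rewrite /cyc_ind -(cyc_inj lin li'n).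
by case: (eqVneq v (cyc i)) => [->|_]; [case: eqP | rewrite min0n].
Qed.

Lemma cyc_side_disjoint i i' v : minn (cyc_ind i v) (side_ind i' v) = 0%N.
Proof.
rewrite /cyc_ind; case: (eqVneq v (cyc i)) => [->|_]; last by rewrite min0n.
by rewrite side_ind_cyc minn0.
Qed.

Lemma side_ind_disjoint i i' v : (i < n)%N -> (i' < n)%N -> i != i' ->
  minn (side_ind i v) (side_ind i' v) = 0%N.
Proof.
move=> lin li'n ii'; case: v => a h; rewrite /side_ind !xpair_eqE.
have := jpred_neq_jsucc.
have : ~~ ((h == k + i%:R + 1) && (h == k + i'%:R + 1)).
  by apply: contraNN ii' => /andP[/eqP-> ]; rewrite (inj_eq (addIr 1)) Zn_natr_inj.
have : ~~ ((h == k + i%:R) && (h == k + i'%:R)).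
  by apply: contraNN ii' => /andP[/eqP-> ]; rewrite Zn_natr_inj.
do 4![case: (h == _)] => //= _ _; case: (eqVneq a jpred) => [->|_].
all: by do ?[case: (_ == _)].
Qed.

(** The sources and targets of cyc s do not overlap, so they are its actual
    neighbours. The bound on s excludes s = n - 2, where cyc s.+1 and cyc n.-1
    coincide and cancel. *)
Lemma row_disjoint s v : (s.+1 < n.-1)%N ->
  minn (cyc_ind s.+1 v + back_ind s v) (cyc_ind n.-1 v + side_ind s v) = 0%N.
Proof.
move=> sn.
have z1 : minn (cyc_ind s.+1 v) (cyc_ind n.-1 v) = 0%N.
  by apply: cyc_ind_disjoint; lia.
have z2 := cyc_side_disjoint s.+1 s v.
have z3 : minn (back_ind s v) (cyc_ind n.-1 v) = 0%N.
  case: s sn {z1 z2} => [|s] sn /=; first by rewrite minnC cyc_side_disjoint.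
  by apply: cyc_ind_disjoint; lia.
have z4 : minn (back_ind s v) (side_ind s v) = 0%N.
  case: s sn {z1 z2 z3} => [|s] sn /=; last exact: cyc_side_disjoint.
  by apply: side_ind_disjoint; lia.
by lia.
Qed.

Lemma cylinder_row (h : 'Z_n) (v : V) :
  exchange_coef (cylinder_quiver n m) (j, h) v =
    ((v == (j, h + 1)%R) + ((v == (jpred, h)) + (v == (jsucc, h - 1)%R)))%N%:Z
    - ((v == (j, h - 1)%R) + ((v == (jpred, h + 1)%R) + (v == (jsucc, h))))%N%:Z.
Proof.
case: v => a l; rewrite /exchange_coef !ffunE /arrows /= !xpair_eqE.
have -> : (a == jpred) = (j == a.+1 :> nat) by rewrite -val_eqE /= val_jpred; lia.
have -> : (a == jsucc) = (a == j.+1 :> nat) by rewrite -val_eqE /= val_jsucc; lia.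
have -> : (h == l + 1) = (l == h - 1) by rewrite -subr_eq (eq_sym l).
have -> : (h == l - 1) = (l == h + 1) by rewrite (eq_sym h) subr_eq.
rewrite (eq_sym h l) (eq_sym j a) -2!addnA.
by congr (Posz (_ + _) - Posz (_ + _)); rewrite addnC.
Qed.

Lemma two_acyclic_cylinder : two_acyclic (cylinder_quiver n m).
Proof.
have nat0 i : (i < n)%N -> (i%:R == 0 :> 'Z_n) = (i == 0%N).
  by move=> lin; rewrite -(@Zn_natr_inj i 0) ?(inj_eq (addrI k)) //; lia.
case=> a h [b l]; rewrite !ffunE /arrows /=.
(* A 2-cycle would make 1 or 2 vanish modulo n. *)
have e1 : ~~ ((l == h + 1) && (h == l + 1)).
  apply/negP => /andP[/eqP-> /eqP]; rewrite -addrA -[LHS]addr0.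
  by move/addrI/esym/eqP; rewrite -[1 + 1]/(2%:R) nat0.
have e2 : ~~ ((l == h) && (h == l - 1)).
  apply/negP => /andP[/eqP-> /eqP]; rewrite -[LHS]addr0.
  by move/addrI/esym/eqP; rewrite oppr_eq0 -(mulr1n 1) nat0 //; lia.
have e3 : ~~ ((h == l) && (l == h - 1)).
  apply/negP => /andP[/eqP-> /eqP]; rewrite -[LHS]addr0.
  by move/addrI/esym/eqP; rewrite oppr_eq0 -(mulr1n 1) nat0 //; lia.
rewrite -!(val_eqE a) -!(val_eqE b) /=; move: e1 e2 e3; rewrite (eq_sym h l).
do 5![case: (_ == _ :> 'Z_n)] => //= _ _ _.
all: rewrite ?andbF ?andbT; lia.
Qed.

Lemma natr_shift i : k + i%:R + 1 = k + i.+1%:R.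
Proof. by rewrite -addrA natr1. Qed.

Lemma natr_period i : k + (n + i)%:R = k + i%:R.
Proof. by rewrite natrD pchar_Zp ?add0r //; lia. Qed.

Lemma cyc_ind_period i : cyc_ind (n + i) = cyc_ind i.
Proof. by rewrite /cyc_ind /cyc natr_period. Qed.

Lemma side_ind_period i : side_ind (n + i) = side_ind i.
Proof. by rewrite /side_ind /west /east natr_period. Qed.

Lemma cylinder_row_cyc i v :
  exchange_coef (cylinder_quiver n m) (cyc i.+1) v =
    (cyc_ind i.+2 v + side_ind i v)%N%:Z
    - (cyc_ind i v + side_ind i.+1 v)%N%:Z.
Proof.
rewrite cylinder_row.
have -> : k + i.+1%:R - 1 = k + i%:R by rewrite -natr_shift addrK.
by rewrite natr_shift /side_ind /west /east !natr_shift.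
Qed.

(** The part of the exchange matrix that determines the next mutations after s
    of them: the rows of the vertices not yet reached are the initial ones, and
    the two other rows close the remaining oriented cycle from s to n - 1. *)
Definition rows_after s (Q : quiver V) :=
  [/\ two_acyclic Q,
    forall i v, (s <= i)%N -> (i.+2 < n)%N ->
      exchange_coef Q (cyc i.+1) v = (cyc_ind i.+2 v + side_ind i v)%N%:Z
                                   - (cyc_ind i v + side_ind i.+1 v)%N%:Z,
    forall v, exchange_coef Q (cyc s) v =
      (cyc_ind s.+1 v + back_ind s v)%N%:Z
      - (cyc_ind n.-1 v + side_ind s v)%N%:Z
    & forall v, exchange_coef Q (cyc n.-1) v =
      (cyc_ind s v + side_ind n.-2 v)%N%:Z
      - (back_ind s v + cyc_ind n.-2 v)%N%:Z].

Lemma rows_initial : rows_after 0 (cylinder_quiver n m).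
Proof.
have n1 : n.-1.+1 = n by lia.
have n2 : n.-2.+1 = n.-1 by lia.
split=> [|i v _ _|v|v]; first exact: two_acyclic_cylinder.
- exact: cylinder_row_cyc.
- have := cylinder_row_cyc n.-1 v.
  by rewrite n1 cyc_period -(cyc_ind_period 1) addn1 -(side_ind_period 0) addn0.
have := cylinder_row_cyc n.-2 v.
by rewrite n2 n1 -(cyc_ind_period 0) addn0 [(cyc_ind n.-2 v + _)%N]addnC.
Qed.

Lemma rows_arrows s (Q : quiver V) v : rows_after s Q -> (s.+2 < n)%N ->
  Q (cyc s, v) = (cyc_ind s.+1 v + back_ind s v)%N
  /\ Q (v, cyc s) = (cyc_ind n.-1 v + side_ind s v)%N.
Proof.
move=> [QP _ Qs _] sn; apply: arrows_from_coef => //.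
by apply: row_disjoint; lia.
Qed.

(** The vertices between cyc s.+1 and cyc n.-1 are not adjacent to cyc s, which therefore acts
    on the two rows of cyc s.+1 (one of its targets) and cyc n.-1 (one of its
    sources) only. *)
Lemma rows_step s (Q : quiver V) : (s.+2 < n)%N ->
  rows_after s Q -> rows_after s.+1 (mutate_quiver (cyc s) Q).
Proof.
move=> sn QR; have [QP Qi Qs Qn] := QR.
split=> [|i v si lin|v|v]; first exact: two_acyclic_mutate.
- have ne : cyc i.+1 != cyc s by rewrite cyc_inj; lia.
  rewrite mutate_row0 //; first by apply: Qi; lia.
  by rewrite exchange_coefN Qs !cyc_ind_cyc ?back_ind_cyc ?side_ind_cyc; lia.
- rewrite mutate_row_target //; last first.
    by rewrite Qi // !cyc_ind_cyc ?side_ind_cyc; lia.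
  rewrite Qi // (rows_arrows v QR sn).2 /back_ind /cyc_ind; lia.
rewrite mutate_row_source //; last first.
  by rewrite Qn !cyc_ind_cyc ?back_ind_cyc ?side_ind_cyc; lia.
rewrite Qn // (rows_arrows v QR sn).1.
have -> : back_ind s.+1 = cyc_ind s by [].
have -> : (v == cyc s) = cyc_ind s v :> nat by [].
lia.
Qed.

Section Variables.
Variable F : fieldType.
Implicit Types (x : {ffun V -> F}) (sd : seed V F).

Definition sweep s sd := mutations [seq cyc i | i <- iota 0 s] sd.

Lemma sweepS s sd : sweep s.+1 sd = mutation (cyc s) (sweep s sd).
Proof.
by rewrite /sweep /mutations -addn1 iotaD map_cat foldl_cat.
Qed.

Lemma rows_sweep x s : (s.+1 < n)%N ->
  rows_after s (sweep s (cylinder_quiver n m, x)).1.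
Proof.
elim: s => [|s IHs] sn; first exact: rows_initial.
by rewrite sweepS; apply: rows_step; [lia | apply: IHs; lia].
Qed.

Lemma sweep_neq s sd v : (forall i, (i < s)%N -> v != cyc i) ->
  (sweep s sd).2 v = sd.2 v.
Proof.
elim: s => // s IHs vP; rewrite sweepS; case: (sweep s sd) IHs => Q y IHs.
rewrite mutation_neq; last exact: vP.
by apply: IHs => i si; apply: vP; lia.
Qed.

Lemma prod_cyc_ind x i : \prod_w x w ^+ cyc_ind i w = x (cyc i).
Proof.
rewrite (bigD1 (cyc i)) //= /cyc_ind eqxx big1 ?mulr1 // => w /negPf->.
by rewrite expr0.
Qed.

Lemma prod_side_ind x i : \prod_w x w ^+ side_ind i w = x (west i) * x (east i).
Proof.
have prod1 u : \prod_w x w ^+ (w == u) = x u.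
  by rewrite (bigD1 u) //= eqxx big1 ?mulr1 // => w /negPf->; rewrite expr0.
rewrite -[x (west i)]prod1 -[x (east i)]prod1 -big_split /=.
by apply: eq_bigr => w _; rewrite -exprD.
Qed.

Definition cycle_term x i :=
  x (west i) * x (east i) / (x (cyc i) * x (cyc i.+1)).

(** The sum starts with the term of index n - 1, which is contributed by the
    arrow from cyc 0 to the pair of index n - 1. *)
Definition partial_sum x s := cycle_term x n.-1 + \sum_(i < s) cycle_term x i.

Lemma partial_sumS x s : partial_sum x s.+1 = partial_sum x s + cycle_term x s.
Proof. by rewrite /partial_sum big_ord_recr addrA. Qed.

Lemma west_neq_cyc i i' : west i != cyc i'.
Proof. by rewrite xpair_eqE (negPf jpred_neq). Qed.

Lemma east_neq_cyc i i' : east i != cyc i'.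
Proof. by rewrite xpair_eqE (negPf jsucc_neq). Qed.

Lemma prod_side_ind_sweep s sd i :
  \prod_w (sweep s sd).2 w ^+ side_ind i w = sd.2 (west i) * sd.2 (east i).
Proof.
rewrite prod_side_ind !sweep_neq // => i' _; first exact: east_neq_cyc.
exact: west_neq_cyc.
Qed.

Section NonZero.
Variable x : {ffun V -> F}.
Hypothesis x0 : forall v, x v != 0.
Let sd := (cylinder_quiver n m, x).

(** For s = 0 this is the equation p_(n-1) = y_0 y_(n-1) t_(n-1); for s > 0 it
    is the value of the variable mutated just before. The common form lets
    all exchange relations of the sweep be treated at once. *)
Lemma prod_back_ind_sweep s : (s < n)%N ->
  (forall i, i.+1 = s ->
    (sweep s sd).2 (cyc i) = x (cyc i.+1) * x (cyc n.-1) * partial_sum x i.+1) ->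
  \prod_w (sweep s sd).2 w ^+ back_ind s w
  = x (cyc s) * x (cyc n.-1) * partial_sum x s.
Proof.
case: s => [|s] sn xs; last by rewrite prod_cyc_ind xs.
have n1 : n.-1.+1 = n by lia.
rewrite prod_side_ind /partial_sum big_ord0 addr0 /cycle_term n1 /=.
by rewrite cyc_period; field; rewrite !x0.
Qed.

(** The exchange relation at cyc s reads
    (y_(n-1) p_s + y_(s+1) y_s y_(n-1) S_s) / y_s = y_(s+1) y_(n-1) (t_s + S_s). *)
Lemma sweep_cyc s i : (s.+1 < n)%N -> (i < s)%N ->
  (sweep s sd).2 (cyc i) = x (cyc i.+1) * x (cyc n.-1) * partial_sum x i.+1.
Proof.
elim: s i => // s IHs i sn; rewrite ltnS leq_eqVlt => /orP[/eqP-> | si]; last first.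
  rewrite sweepS; case E: (sweep s sd) => [Q y].
  rewrite mutation_neq; last by rewrite cyc_inj; lia.
  by rewrite -[y]/((Q, y).2) -E; apply: IHs => //; lia.
have IH i' : i'.+1 = s -> (sweep s sd).2 (cyc i')
    = x (cyc i'.+1) * x (cyc n.-1) * partial_sum x i'.+1.
  by move=> si; apply: IHs; lia.
have back := prod_back_ind_sweep (ltn_trans (ltnSn _) (ltnW sn)) IH.
have side : \prod_w (sweep s sd).2 w ^+ side_ind s w = x (west s) * x (east s).
  exact: prod_side_ind_sweep.
have xi i' : (s <= i' < n)%N -> (sweep s sd).2 (cyc i') = x (cyc i').
  by move=> /andP[si' li'n]; apply: sweep_neq => i'' ?; rewrite cyc_inj; lia.
have QR : rows_after s (sweep s sd).1 by apply: rows_sweep; lia.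
have [QP _ _ _] := QR.
rewrite sweepS; move: QR QP back side xi; case: (sweep s sd)
  => Q y /= QR QP back side xi.
rewrite mutation_eq // /exchange_poly.
rewrite (eq_bigr
  (fun w => y w ^+ cyc_ind n.-1 w * y w ^+ side_ind s w)); last first.
  by move=> w _; rewrite (rows_arrows w QR sn).2 exprD.
rewrite [X in _ + X](eq_bigr
  (fun w => y w ^+ cyc_ind s.+1 w * y w ^+ back_ind s w)); last first.
  by move=> w _; rewrite (rows_arrows w QR sn).1 exprD.
rewrite !big_split /= !prod_cyc_ind back side !xi; try lia.
by rewrite partial_sumS /cycle_term; field; rewrite !x0.
Qed.

(** At s = n - 2 the terms cyc_ind n.-1 of the row of cyc s cancel, which makes
    the rows of the last two vertices opposite. These vertices are then not
    adjacent, and both exchange relations have the same numerator. *)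
Lemma exchange_poly_turn : let: (Q, y) := sweep n.-2 sd in
  [/\ forall v, exchange_coef Q (cyc n.-1) v = - exchange_coef Q (cyc n.-2) v,
      exchange_poly Q (cyc n.-2) y
      = x (cyc n.-2) * x (cyc n.-1) * partial_sum x n.-1
    & exchange_poly (mutate_quiver (cyc n.-2) Q) (cyc n.-1)
        (mutate_vars (cyc n.-2) Q y)
      = x (cyc n.-2) * x (cyc n.-1) * partial_sum x n.-1].
Proof.
have n2 : n.-2.+1 = n.-1 by lia.
have QR : rows_after n.-2 (sweep n.-2 sd).1 by apply: rows_sweep; lia.
have back : \prod_w (sweep n.-2 sd).2 w ^+ back_ind n.-2 w
    = x (cyc n.-2) * x (cyc n.-1) * partial_sum x n.-2.
  by apply: prod_back_ind_sweep => [|i si]; [lia | apply: sweep_cyc; lia].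
have side : \prod_w (sweep n.-2 sd).2 w ^+ side_ind n.-2 w
    = x (west n.-2) * x (east n.-2) by exact: prod_side_ind_sweep.
case: (sweep n.-2 sd) QR back side => Q y /= [QP _ Qs Qn] back side.
have Es v : exchange_coef Q (cyc n.-2) v
    = (back_ind n.-2 v)%:Z - (side_ind n.-2 v)%:Z.
  by rewrite Qs n2; lia.
have En v : exchange_coef Q (cyc n.-1) v
    = (side_ind n.-2 v)%:Z - (back_ind n.-2 v)%:Z.
  by rewrite Qn; lia.
have disj v : minn (back_ind n.-2 v) (side_ind n.-2 v) = 0%N.
  have -> : back_ind n.-2 = cyc_ind n.-2.-1 by apply: back_ind_pred; lia.
  exact: cyc_side_disjoint.
have self0 : back_ind n.-2 (cyc n.-2) = 0%N /\ side_ind n.-2 (cyc n.-2) = 0%N.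
  by rewrite back_ind_cyc ?side_ind_cyc; lia.
have vals : x (west n.-2) * x (east n.-2)
    + x (cyc n.-2) * x (cyc n.-1) * partial_sum x n.-2
    = x (cyc n.-2) * x (cyc n.-1) * partial_sum x n.-1.
  have -> : partial_sum x n.-1 = partial_sum x n.-2 + cycle_term x n.-2.
    by rewrite -partial_sumS n2.
  by rewrite /cycle_term n2; field; rewrite !x0.
have arr v := arrows_from_coef QP (Es v) (disj v).
have Q'P := two_acyclic_mutate (cyc n.-2) QP.
have arr' v : mutate_quiver (cyc n.-2) Q (cyc n.-1, v) = side_ind n.-2 v
              /\ mutate_quiver (cyc n.-2) Q (v, cyc n.-1) = back_ind n.-2 v.
  apply: arrows_from_coef => //; last by rewrite minnC.
  rewrite mutate_row0 //; first by rewrite cyc_inj; lia.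
  by rewrite En self0.1 self0.2.
split=> [v||].
- by rewrite En Es opprB.
- rewrite /exchange_poly -vals -side -back.
  by congr (_ + _); apply: eq_bigr => w _; rewrite ?(arr w).1 ?(arr w).2.
rewrite /exchange_poly addrC -vals -side -back.
have y'E w : w != cyc n.-2 -> mutate_vars (cyc n.-2) Q y w = y w.
  by rewrite ffunE => /negPf->.
congr (_ + _); apply: eq_bigr => w _; rewrite ?(arr' w).1 ?(arr' w).2.
  by case: (eqVneq w (cyc n.-2)) => [->|/y'E-> //]; rewrite self0.2 !expr0.
by case: (eqVneq w (cyc n.-2)) => [->|/y'E-> //]; rewrite self0.1 !expr0.
Qed.

Hypothesis S0 : forall s, (0 < s < n)%N -> partial_sum x s != 0.

(** Each mutation is undone by itself, the variables being nonzero. *)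
Lemma sweepK s : (s.+1 < n)%N ->
  mutations (rev [seq cyc i | i <- iota 0 s]) (sweep s sd) = sd.
Proof.
elim: s => // s IHs sn; have {}IHs := IHs (ltnW sn).
rewrite -addn1 iotaD map_cat rev_cat /= -[cyc (0 + s)]/(cyc s) addn1 sweepS.
rewrite -[mutations _ _]/(mutations _ (mutation (cyc s) _)) -[RHS]IHs.
congr (mutations _ _).
have new : (sweep s.+1 sd).2 (cyc s) != 0.
  by rewrite sweep_cyc // !mulf_neq0 ?x0 ?S0 //; lia.
have old : (sweep s sd).2 (cyc s) != 0.
  by rewrite sweep_neq ?x0 // => i si; rewrite cyc_inj; lia.
have [QP _ _ _] : rows_after s (sweep s sd).1 by apply: rows_sweep; lia.
by move: new old QP; rewrite sweepS; case: (sweep s sd) => Q y *; apply: mutationK.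
Qed.

End NonZero.

Definition scaled x c : {ffun V -> F} :=
  [ffun v => if v.1 == j then c * x v else x v].

Lemma scaled_cyc x c i : scaled x c (cyc i) = c * x (cyc i).
Proof. by rewrite ffunE eqxx. Qed.

(** The denominator of each term has two factors in the cycle, the numerator
    none. *)
Lemma partial_sum_scaled x c s : c != 0 -> (forall v, x v != 0) ->
  partial_sum (scaled x c) s = partial_sum x s / c ^+ 2.
Proof.
move=> c0 x0.
have termE i : cycle_term (scaled x c) i = cycle_term x i / c ^+ 2.
  rewrite /cycle_term !scaled_cyc !ffunE /= (negPf jpred_neq) (negPf jsucc_neq).
  by field; rewrite c0 !x0.
rewrite /partial_sum termE mulrDl mulr_suml; congr (_ + _).
by apply: eq_bigr.
Qed.

Lemma sweep_quiver s Q x x' : (sweep s (Q, x)).1 = (sweep s (Q, x')).1.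
Proof. by elim: s => // s; rewrite !sweepS /= => ->. Qed.

Section Turn.
Variable x : {ffun V -> F}.
Hypothesis x0 : forall v, x v != 0.
Hypothesis S0 : forall s, (0 < s < n)%N -> partial_sum x s != 0.
Let Q0 := cylinder_quiver n m.
Let T := partial_sum x n.-1.

(** Both seeds have the quiver reached by the sweep. On the vertices of the
    sweep the factors T^2 and T^(-2) cancel; on the last two vertices, the
    exchange relations give T y_(n-1) at n - 2 and T y_(n-2) at n - 1, whence the
    exchange of labels. *)
Lemma turn_sweep :
  exchange_labels (cyc n.-2) (cyc n.-1)
    (mutation (cyc n.-1) (mutation (cyc n.-2) (sweep n.-2 (Q0, x))))
  = sweep n.-2 (Q0, scaled x T).
Proof.
have T0 : T != 0 by apply: S0; lia.
have ne : cyc n.-2 != cyc n.-1 by rewrite cyc_inj; lia.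
have x'0 v : scaled x T v != 0 by rewrite ffunE; case: ifP; rewrite ?mulf_neq0 ?x0.
have := exchange_poly_turn x0.
have QR : rows_after n.-2 (sweep n.-2 (Q0, x)).1 by apply: rows_sweep; lia.
have Q'E := sweep_quiver n.-2 Q0 x (scaled x T).
have lo i : (i < n.-2)%N -> (sweep n.-2 (Q0, x)).2 (cyc i)
    = (sweep n.-2 (Q0, scaled x T)).2 (cyc i).
  move=> lin; rewrite !sweep_cyc //; try lia.
  by rewrite partial_sum_scaled // !scaled_cyc; field.
have hi v : (forall i, (i < n.-2)%N -> v != cyc i) ->
  (sweep n.-2 (Q0, x)).2 v = x v /\ (sweep n.-2 (Q0, scaled x T)).2 v = scaled x T v.
  by move=> vP; rewrite !sweep_neq.
case: (sweep n.-2 (Q0, scaled x T)) Q'E lo hi => Q' y' /=.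
case: (sweep n.-2 (Q0, x)) QR => Q y /= [QP _ _ _] <- lo hi [opp E1 E2].
have Q1P := two_acyclic_mutate (cyc n.-2) QP.
congr (_, _); first exact: opposite_rows_exchange.
have top i : (n.-2 <= i < n)%N ->
    y (cyc i) = x (cyc i) /\ y' (cyc i) = T * x (cyc i).
  by move=> lin; rewrite -scaled_cyc; apply: hi => i' ?; rewrite cyc_inj; lia.
have y2 : mutate_vars (cyc n.-2) Q y (cyc n.-2) = T * x (cyc n.-1).
  rewrite mutate_varsE // eqxx E1 (top _ _).1; last by lia.
  by rewrite -/T; field; rewrite x0.
have y1 : mutate_vars (cyc n.-1) (mutate_quiver (cyc n.-2) Q)
            (mutate_vars (cyc n.-2) Q y) (cyc n.-1) = T * x (cyc n.-2).
  rewrite mutate_varsE // eqxx E2 mutate_varsE // eq_sym (negPf ne).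
  rewrite (top _ _).1; last by lia.
  by rewrite -/T; field; rewrite x0.
apply/ffunP => v; rewrite ffunE; case: tpermP => [->|->|/eqP v2 /eqP v1].
- by rewrite y1 (top _ _).2 //; lia.
- by rewrite mutate_varsE // (negPf ne) y2 (top _ _).2 //; lia.
rewrite mutate_varsE // (negPf v1) mutate_varsE // (negPf v2).
have [/in_cycle[i lin vi]|vj] := eqVneq v.1 j; last first.
  have vc i : v != cyc i by apply: contraNneq vj => ->.
  by rewrite (hi v _).1 ?(hi v _).2 // ffunE (negPf vj).
subst v; apply: lo; move: v1 v2; rewrite !cyc_inj; lia.
Qed.

Lemma exchange_labels_mutations a b ks (sd : seed V F) :
  exchange_labels a b (mutations ks sd)
  = mutations (map (tperm a b) ks) (exchange_labels a b sd).
Proof. by elim: ks sd => //= u ks IHs sd; rewrite IHs exchange_labels_mutation. Qed.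

(** The label exchange commutes with the descending mutations, none of which is
    at n - 2 or n - 1. Once it is performed before them, they undo the sweep of
    the scaled seed. *)
Lemma R_operation_scaled : R_operation j k (Q0, x) = (Q0, scaled x T).
Proof.
have T0 : T != 0 by apply: S0; lia.
have e2 : (j, k - 2) = cyc n.-2.
  congr (_, _ + _); apply/eqP; rewrite eq_sym -addr_eq0 -natrD.
  have -> : (n.-2 + 2 = n)%N by lia.
  by rewrite pchar_Zp //; lia.
have e1 : (j, k - 1) = cyc n.-1.
  congr (_, _ + _); apply/eqP; rewrite eq_sym -addr_eq0 natr1.
  have -> : (n.-1.+1 = n)%N by lia.
  by rewrite pchar_Zp //; lia.
rewrite /R_operation e1 e2 exchange_labels_mutations.
set down := map _ _.
have -> : down = rev [seq cyc i | i <- iota 0 n.-2].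
  rewrite /down -map_comp map_rev subn2; congr rev; apply/eq_in_map => i.
  rewrite mem_iota add0n => /= lin; rewrite -[(j, _)]/(cyc i).
  by rewrite tpermD // cyc_inj; lia.
have -> : [seq (j, k + i%:R) | i <- iota 0 n]
    = rcons (rcons [seq cyc i | i <- iota 0 n.-2] (cyc n.-2)) (cyc n.-1).
  have iotaE : iota 0 n = rcons (rcons (iota 0 n.-2) n.-2) n.-1.
    have {1}-> : n = (n.-2 + 1 + 1)%N by lia.
    by rewrite !iotaD /= !add0n addn1 !cats1; congr rcons; lia.
  by rewrite iotaE !map_rcons.
rewrite /mutations !foldl_rcons -/(mutations _ _) -/(sweep _ _) turn_sweep.
apply: sweepK => [v|s sn|]; last by lia.
  by rewrite ffunE; case: ifP; rewrite ?mulf_neq0 ?x0.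
by rewrite partial_sum_scaled // mulf_neq0 ?S0 // invr_eq0 expf_neq0.
Qed.

End Turn.
End Variables.

End Sweep.

(** * The cycle sum as the R-matrix, and positivity *)

Section CycleSum.
Variables (n m : nat) (j : 'I_m.+1) (k : 'Z_n) (F : fieldType).
Hypothesis n3 : (3 <= n)%N.
Variable x : {ffun vertex n m -> F}.
Hypothesis x0 : forall v, x v != 0.

Lemma partial_sum_full : partial_sum j k x n.-1 =
  \sum_(l : 'Z_n) x (inord j.-1, l + 1) * x (inord j.+1, l)
                  / (x (j, l) * x (j, l + 1)).
Proof.
pose f (l : 'Z_n) := x (inord j.-1, l + 1) * x (inord j.+1, l)
                     / (x (j, l) * x (j, l + 1)).
have termE i : cycle_term j k x i = f (k + i%:R).
  by rewrite /cycle_term /f /cyc -natr_shift.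
transitivity (\sum_(i < n.-1.+1) cycle_term j k x i).
  by rewrite big_ord_recr /= addrC.
have -> : n.-1.+1 = (Zp_trunc n).+2 by rewrite Zp_cast; lia.
rewrite -/(f _) [RHS](reindex_inj (addrI k)).
by apply: eq_bigr => l _; rewrite termE natr_Zp.
Qed.

(** With P the product of all variables of the cycle, the numerator is P T and
    the denominator P / x_(j,h). *)
Lemma R_image_partial_sum (h : 'Z_n) :
  R_num j x / R_den j x h = partial_sum j k x n.-1 * x (j, h).
Proof.
pose P := \prod_h x (j, h).
have P0 : P != 0 by apply/prodf_neq0.
have -> : R_den j x h = P / x (j, h).
  by rewrite /R_den /P [X in X / _](bigD1 h) //= mulrC mulKf.
have -> : R_num j x = P * partial_sum j k x n.-1.
  rewrite /R_num partial_sum_full mulr_sumr; apply: eq_bigr => l _.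
  have l1 : l + 1 != l by rewrite -subr_eq0 addrC addKr oner_eq0.
  have -> : P = x (j, l) * (x (j, l + 1)
      * \prod_(h : 'Z_n | (h != l) && (h != l + 1)) x (j, h)).
    by rewrite /P (bigD1 l) // (bigD1 (l + 1)).
  by field; rewrite !x0.
by field; rewrite P0 x0.
Qed.

End CycleSum.

Section Positivity.
Variable V : finType.

Definition at_one : {mpoly rat[#|V|]} -> rat := meval (fun=> 1).

(** A subsemifield of the rational functions that contains the variables but
    not 0: it replaces the notion of a subtraction-free expression. *)
Definition positive (r : ratfun V) := exists a b,
  [/\ 0 < at_one a, 0 < at_one b & r = tofrac a / tofrac b].

Lemma tofrac_at_one_neq0 a : 0 < at_one a -> tofrac a != 0 :> ratfun V.
Proof.
by rewrite tofrac_eq0; apply: contraTneq => ->;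
  rewrite /at_one rmorph0 Order.POrderTheory.ltxx.
Qed.

Lemma positive_neq0 r : positive r -> r != 0.
Proof.
by case=> a [b [a0 b0 ->]]; rewrite mulf_neq0 ?invr_eq0 ?tofrac_at_one_neq0.
Qed.

Lemma positiveD r s : positive r -> positive s -> positive (r + s).
Proof.
move=> [a [b [a0 b0 ->]]] [c [d [c0 d0 ->]]]; exists (a * d + c * b), (b * d).
rewrite /at_one !rmorphD !rmorphM /= addr_gt0 ?mulr_gt0 //; split=> //.
by rewrite addf_div ?tofrac_at_one_neq0 ?rmorphM.
Qed.

Lemma positiveM r s : positive r -> positive s -> positive (r * s).
Proof.
move=> [a [b [a0 b0 ->]]] [c [d [c0 d0 ->]]]; exists (a * c), (b * d).
by rewrite /at_one !rmorphM /= !mulr_gt0 // mulf_div; split.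
Qed.

Lemma positiveV r : positive r -> positive r^-1.
Proof. by move=> [a [b [a0 b0 ->]]]; exists b, a; rewrite invf_div. Qed.

Lemma positive_var v : positive (var v).
Proof.
by exists (pvar v), 1; rewrite /at_one rmorph1 /= mevalXU rmorph1 divr1 !ltr01.
Qed.

End Positivity.

Lemma positive_partial_sum n m (j : 'I_m.+1) (k : 'Z_n) s :
  positive (partial_sum j k [ffun v => var v] s).
Proof.
have term i : positive (cycle_term j k [ffun v => var v] i).
  rewrite /cycle_term !ffunE.
  by apply: positiveM; [|apply: positiveV]; apply: positiveM; apply: positive_var.
elim: s => [|s IHs]; first by rewrite /partial_sum big_ord0 addr0; apply: term.
by rewrite partial_sumS; apply: positiveD.
Qed.

Theorem theorem3p1 (n m : nat) (hn : (3 <= n)%N) (hm : (2 <= m)%N)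
    (j : 'I_m.+1) (hj : (0 < j < m)%N) (k : 'Z_n) :
  R_operation j k (initial_seed n m)
  = (cylinder_quiver n m, [ffun v => cluster_R n hj (var v)]).
Proof.
pose x : {ffun vertex n m -> ratfun (vertex n m)} := [ffun v => var v].
have x0 v : x v != 0 by rewrite ffunE; apply/positive_neq0/positive_var.
rewrite /initial_seed -/x (@R_operation_scaled n m j k hn hj _ x x0); last first.
  by move=> s _; apply/positive_neq0/positive_partial_sum.
congr (_, _); apply/ffunP => v; rewrite !ffunE cluster_R_var /R_image.
case: v => a h /=; case: eqP => // ->.
rewrite -(ffunE (@var _)) -/x -R_image_partial_sum //.
have xE : x =1 @var (vertex n m) by move=> w; rewrite ffunE.
by rewrite (R_num_eq _ xE) /R_den; congr (_ / _); apply: eq_bigr => i _; rewrite xE.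
Qed.
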